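(* Let $G_1,G_2$ be finite connected simple graphs, $x_1\in V(G_1)$, $x_2\in V(G_2)$, and let $G=G_1[x_1]\oplus G_2[x_2]$. Assume $\lambda_{\max}(G_1)\geq\lambda_{\max}(G_2)$, and write $\mu=\lambda_{\max}(G_1)$. Then $m_G(\mu)\in\{m_{G_1}(\mu)+m_{G_2}(\mu),\ m_{G_1}(\mu)+m_{G_2}(\mu)-1\}$. More precisely: (1) If, for $i=1,2$, every function $h_i:V(G_i)\to\mathbb{R}$ with $\mathrm{RQ}_{G_i}(h_i)=\mu$ satisfies $h_i(x_i)=0$, then $m_G(\mu)=m_{G_1}(\mu)+m_{G_2}(\mu)$. (2) Otherwise, $m_G(\mu)=m_{G_1}(\mu)+m_{G_2}(\mu)-1$.
   Context: The $1$-sum $G_1[x_1]\oplus G_2[x_2]$ is obtained from the disjoint union of $G_1$ and $G_2$ by identifying $x_1$ and $x_2$ into a single new vertex. $\lambda_{\max}(H)$ is the largest eigenvalue of the normalized Laplacian $L=\mathrm{Id}-D^{-1}A$ of a graph $H$, and $m_H(\lambda)$ the multiplicity of $\lambda$ as an eigenvalue of it (zero if not an eigenvalue). For $h:V(H)\to\mathbb{R}$ not identically zero, $\mathrm{RQ}_H(h)=\frac{\sum_{\{v,w\}\in E(H)}(h(v)-h(w))^2}{\sum_{v\in V(H)}\deg_H v\,h(v)^2}$. *)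

(* Defs.v *)
From mathcomp Require Import all_boot all_order all_algebra.
From mathcomp Require Import boolp classical_sets reals.

Set Implicit Arguments.
Unset Strict Implicit.
Unset Printing Implicit Defensive.

Import Order.TTheory GRing.Theory Num.Theory.
Local Open Scope ring_scope.

Record sgraph := SGraph {
  vertex :> finType;
  adj : rel vertex;
  adj_sym : symmetric adj;
  adj_irrefl : irreflexive adj }.

Definition deg (G : sgraph) (v : G) : nat := #|[pred w | adj v w]|.

Definition connected_graph (G : sgraph) : Prop :=
  forall v w : G, connect (@adj G) v w.

Section OneSum.
Variables (G1 G2 : sgraph) (x1 : G1) (x2 : G2).

(* [None] is the vertex obtained by identifying [x1] and [x2]. *)
Definition onesum_vertex : finType :=
  option ({a : G1 | a != x1} + {b : G2 | b != x2})%type.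

(* Quotient map from the disjoint union; [insub a] is [None] iff [a = x1]. *)
Definition onesum_proj (s : G1 + G2) : onesum_vertex :=
  match s with
  | inl a => omap inl (insub a : option {a : G1 | a != x1})
  | inr b => omap inr (insub b : option {b : G2 | b != x2})
  end.

Definition disjoint_adj : rel (G1 + G2)%type := fun s t =>
  match s, t with
  | inl a, inl b => adj a b
  | inr a, inr b => adj a b
  | _, _ => false
  end.

Definition onesum_adj : rel onesum_vertex := fun u w =>
  [exists s, exists t,
    [&& onesum_proj s == u, onesum_proj t == w & disjoint_adj s t]].

Lemma onesum_adj_sym : symmetric onesum_adj.
Proof.
suff H u w : onesum_adj u w -> onesum_adj w u.
  by move=> u w; apply/idP/idP; apply: H.
case/existsP=> s /existsP[t /and3P[pu pw st]].
apply/existsP; exists t; apply/existsP; exists s; rewrite pu pw /=.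
by case: s t st {pu pw} => s [] t //=; rewrite adj_sym.
Qed.

Lemma onesum_adj_irrefl : irreflexive onesum_adj.
Proof.
move=> u; apply: contraTF isT => H; exfalso; case/existsP: H => s /existsP[t /and3P[/eqP <- /eqP]].
case: s t => s [] t //=; case: insubP => [s' _ <-|]; case: insubP => [t' _ <-|] //=.
- by case=> ->; rewrite adj_irrefl.
- by rewrite !negbK => /eqP -> /eqP -> _; rewrite adj_irrefl.
- by case=> ->; rewrite adj_irrefl.
- by rewrite !negbK => /eqP -> /eqP -> _; rewrite adj_irrefl.
Qed.

Definition onesum : sgraph := SGraph onesum_adj_sym onesum_adj_irrefl.

End OneSum.

Section Spectrum.
Variables (R : realType) (G : sgraph).

Definition adj_mx : 'M[R]_#|G| :=
  \matrix_(i, j) (adj (enum_val i) (enum_val j))%:R.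

Definition deg_mx : 'M[R]_#|G| :=
  diag_mx (\row_i (deg (enum_val i))%:R).

(* Meaningful only without isolated vertices, so that [deg_mx] is invertible. *)
Definition laplacian : 'M[R]_#|G| := 1%:M - invmx deg_mx *m adj_mx.

(* [eigenvalue] and [eigenspace] act on row vectors, whereas functions on the
   vertices are column vectors for [laplacian]; hence the transpositions. *)
Definition lambda_max : R :=
  xget 0 [set a | eigenvalue laplacian^T a /\
                  forall b, eigenvalue laplacian^T b -> b <= a]%classic.

Definition mult (a : R) : nat := \rank (eigenspace laplacian^T a).

(* The sum over ordered pairs counts every edge twice. *)
Definition RQ (h : G -> R) : R :=
  (2^-1 * (\sum_(v : G) \sum_(w : G | adj v w) (h v - h w) ^+ 2))
  / (\sum_(v : G) (deg v)%:R * h v ^+ 2).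

Definition RQ_vanish_at (a : R) (x : G) : Prop :=
  forall h : G -> R, (exists v, h v != 0) -> RQ h = a -> h x = 0.

End Spectrum.

Arguments lambda_max R G : clear implicits.

(* Main.v *)
Require Import Defs.
From mathcomp Require Import all_boot all_order all_algebra.
From mathcomp Require Import boolp classical_sets reals.
From mathcomp Require Import ring lra.

Set Implicit Arguments.
Unset Strict Implicit.
Unset Printing Implicit Defensive.

Import Order.TTheory GRing.Theory Num.Theory.
Local Open Scope ring_scope.

(* A function on the 1-sum [G] is a pair [(f1, f2)] of functions on the two parts
   with [f1 x1 = f2 x2], and the quadratic form [a D(f) - Q(f)] of [G], where
   [Q] is the numerator and [D] the denominator of the Rayleigh quotient, is the
   sum of those of the parts.  For [a] at least both greatest eigenvalues these
   forms are positive semidefinite, so their isotropic functions are exactly the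
   eigenfunctions for [a].  Hence the eigenspace of [G] is the kernel of
   [f1 x1 - f2 x2] on the direct sum of the eigenspaces of [G1] and [G2], and
   this functional vanishes iff all eigenfunctions vanish at [x1] and [x2]. *)

(** * Positive semidefinite quadratic forms and matrix pencils *)

Section QuadraticForms.
Variables (R : realType) (n : nat).
Implicit Types (N B D K : 'M[R]_n) (u v : 'rV[R]_n).

Definition bform N u v : R := (u *m N *m v^T) 0 0.

Definition psd N : Prop := forall u, 0 <= bform N u u.

Lemma bformE N u v : bform N u v = \sum_j (u *m N) 0 j * v 0 j.
Proof. by rewrite /bform mxE; apply: eq_bigr => j _; rewrite !mxE. Qed.

Lemma bformDl N u1 u2 v : bform N (u1 + u2) v = bform N u1 v + bform N u2 v.
Proof. by rewrite /bform !mulmxDl mxE. Qed.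

Lemma bformDr N u v1 v2 : bform N u (v1 + v2) = bform N u v1 + bform N u v2.
Proof. by rewrite /bform linearD mulmxDr mxE. Qed.

Lemma bformZl N c u v : bform N (c *: u) v = c * bform N u v.
Proof. by rewrite /bform -!scalemxAl mxE. Qed.

Lemma bformZr N c u v : bform N u (c *: v) = c * bform N u v.
Proof. by rewrite /bform linearZ -scalemxAr mxE. Qed.

Lemma bform_pencil D K a u v :
  bform (a *: D - K) u v = a * bform D u v - bform K u v.
Proof. by rewrite /bform mulmxBr mulmxBl -scalemxAr -scalemxAl !mxE. Qed.

Lemma bformC N u v : N^T = N -> bform N v u = bform N u v.
Proof.
move=> symN; rewrite /bform -[in LHS](trmxK (v *m N *m u^T)) mxE.
by rewrite !trmx_mul trmxK symN mulmxA.
Qed.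

(** The form is nonnegative at [u + t v] for every [t]; the inequality is the discriminant condition
    for this quadratic in [t]. *)
Lemma psd_cauchy_schwarz N u v : N^T = N -> psd N ->
  bform N u v ^+ 2 <= bform N u u * bform N v v.
Proof.
move=> symN psdN.
have main t : 0 <= bform N u u + 2 * t * bform N u v + t ^+ 2 * bform N v v.
  have := psdN (u + t *: v).
  rewrite bformDl !bformDr !bformZl !bformZr (bformC _ _ symN).
  by congr (_ <= _); ring.
have [v0|v0] := eqVneq (bform N v v) 0.
  rewrite v0 mulr0; have [->|w0] := eqVneq (bform N u v) 0.
    by rewrite expr0n.
  (* For isotropic [v] the quadratic is affine in [t], and this [t] gives it the value -1. *)
  have := main (- (bform N u u + 1) / (2 * bform N u v)).
  rewrite v0 mulr0 addr0.
  have -> : 2 * (- (bform N u u + 1) / (2 * bform N u v)) * bform N u v =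
            - (bform N u u + 1) by field.
  lra.
have v_gt0 : 0 < bform N v v by rewrite lt_def v0 psdN.
have := main (- bform N u v / bform N v v).
have -> : bform N u u + 2 * (- bform N u v / bform N v v) * bform N u v +
   (- bform N u v / bform N v v) ^+ 2 * bform N v v =
   (bform N u u * bform N v v - bform N u v ^+ 2) / bform N v v by field.
by rewrite pmulr_lge0 ?invr_gt0 // subr_ge0.
Qed.

(** Cauchy-Schwarz against each basis vector kills every coordinate of [u *m N]. *)
Lemma psd_isotropic N u : N^T = N -> psd N -> bform N u u = 0 -> u *m N = 0.
Proof.
move=> symN psdN u0; apply/rowP => j; rewrite [RHS]mxE.
have := psd_cauchy_schwarz u (delta_mx 0 j) symN psdN.
rewrite u0 mul0r bformE (bigD1 j) //= big1 => [|i ij]; last first.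
  by rewrite [delta_mx _ _ _ _]mxE (negPf ij) andbF mulr0.
rewrite [delta_mx _ _ _ _]mxE !eqxx mulr1 addr0 => sq_le0.
by apply/eqP; rewrite -sqrf_eq0 eq_le sq_le0 sqr_ge0.
Qed.

Lemma bform_diag (d : 'rV[R]_n) u v :
  bform (diag_mx d) u v = \sum_j d 0 j * (u 0 j * v 0 j).
Proof.
by rewrite bformE; apply: eq_bigr => j _; rewrite mul_mx_diag mxE; ring.
Qed.

Lemma bform_diag_ge (d u : 'rV[R]_n) i : (forall j, 0 < d 0 j) ->
  d 0 i * u 0 i ^+ 2 <= bform (diag_mx d) u u.
Proof.
move=> d_gt0; rewrite bform_diag (bigD1 i) //= -expr2 lerDl.
by apply: sumr_ge0 => j _; apply: mulr_ge0; [exact: ltW | exact: sqr_ge0].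
Qed.

Lemma bform_diag_ge0 (d u : 'rV[R]_n) :
  (forall j, 0 < d 0 j) -> 0 <= bform (diag_mx d) u u.
Proof.
move=> d_gt0; rewrite bform_diag sumr_ge0 // => j _.
by apply: mulr_ge0; [exact: ltW | exact: sqr_ge0].
Qed.

Lemma bform_diag_gt0 (d u : 'rV[R]_n) : (forall j, 0 < d 0 j) -> u != 0 ->
  0 < bform (diag_mx d) u u.
Proof.
move=> d_gt0 /rV0Pn[i ui]; apply: lt_le_trans (bform_diag_ge u i d_gt0).
by rewrite mulr_gt0 // exprn_even_gt0.
Qed.

(** A positive diagonal form [D] dominates every form, since [|u_i u_j| <= u_i^2 + u_j^2] and
    [d_i u_i^2 <= D(u,u)]. *)
Lemma bform_bounded (d : 'rV[R]_n) B : (forall j, 0 < d 0 j) ->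
  exists2 C, 0 < C & forall u, `|bform B u u| <= C * bform (diag_mx d) u u.
Proof.
move=> d_gt0; pose D := diag_mx d.
have D_ge0 u : 0 <= bform D u u by apply: bform_diag_ge0.
pose C := \sum_j \sum_i `|B i j| * ((d 0 i)^-1 + (d 0 j)^-1).
have C_ge0 : 0 <= C.
  apply: sumr_ge0 => j _; apply: sumr_ge0 => i _.
  by rewrite mulr_ge0 // addr_ge0 // invr_ge0 ltW.
(* The summand 1 keeps the constant positive even when [B = 0]. *)
exists (C + 1) => [|u]; first by rewrite ltr_wpDl.
apply: (@le_trans _ _ (C * bform D u u)); last by rewrite ler_wpM2r // lerDl.
rewrite bformE mulr_suml (le_trans (ler_norm_sum _ _ _)) // ler_sum // => j _.
rewrite mxE !mulr_suml (le_trans (ler_norm_sum _ _ _)) // ler_sum // => i _.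
rewrite [u 0 i * _]mulrC -!mulrA normrM ler_wpM2l //.
have bnd k : u 0 k ^+ 2 <= (d 0 k)^-1 * bform D u u.
  by rewrite ler_pdivlMl // bform_diag_ge.
rewrite mulrDl; apply: le_trans (lerD (bnd i) (bnd j)).
by rewrite ler_norml; apply/andP; split; nra.
Qed.

(* The greatest generalized eigenvalue is the least [a] for which [a D - K] is
   positive semidefinite: if that form were nondegenerate with matrix [N], then
   Cauchy-Schwarz applied to [u] and [u D N^-1] would give
   [D(u,u) <= C N(u,u)], and [a] could be lowered by [C^-1]. *)
Lemma pencil_max_eigenvalue (d : 'rV[R]_n) K :
  (0 < n)%N -> (forall j, 0 < d 0 j) -> K^T = K ->
  exists2 a, psd (a *: diag_mx d - K) &
    exists2 u : 'rV[R]_n, u != 0 & u *m (a *: diag_mx d - K) = 0.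
Proof.
move=> n_gt0 d_gt0 symK; pose D := diag_mx d.
have symN a : (a *: D - K)^T = a *: D - K.
  by rewrite linearB linearZ /= tr_diag_mx symK.
pose S := [set a | psd (a *: D - K)]%classic.
have [C C_gt0 bndK] := bform_bounded K d_gt0.
have SC : S C.
  by move=> u; rewrite bform_pencil subr_ge0 (le_trans (ler_norm _)) ?bndK.
pose e : 'rV[R]_n := const_mx 1.
have e_neq0 : e != 0.
  by apply/rV0Pn; exists (Ordinal n_gt0); rewrite mxE oner_eq0.
(* Testing semidefiniteness on one nonzero vector bounds [S] from below. *)
have lbS : lbound S (bform K e e / bform D e e).
  move=> a /(_ e); rewrite bform_pencil subr_ge0.
  by rewrite ler_pdivrMr // bform_diag_gt0.
have infS : has_inf S by split; [exists C | eexists; exact: lbS].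
pose m := inf S.
(* For each nonzero [u] the condition on [a] reads [K(u,u) / D(u,u) <= a], which passes to the
   infimum. *)
have Sm : S m.
  move=> u; have [->|u0] := eqVneq u 0.
    by rewrite bformE big1 // => j _; rewrite mul0mx mxE mul0r.
  have Du := bform_diag_gt0 d_gt0 u0.
  rewrite bform_pencil subr_ge0 -ler_pdivrMr //; apply: lb_le_inf; first by exists C.
  by move=> a /(_ u); rewrite bform_pencil subr_ge0 ler_pdivrMr.
exists m => //; pose N := m *: D - K; rewrite -/D -/N.
have [unitN|singN] := boolP (N \in unitmx); last first.
  have /rowV0Pn[u uN u0] : kermx N != 0.
    by rewrite kermx_eq0 row_free_unit.
  by exists u => //; apply/sub_kermxP.
have [C' C'_gt0 bnd] := bform_bounded (D *m invmx N *m D) d_gt0.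
have : S (m - C'^-1).
  move=> u; have [->|u0] := eqVneq u 0.
    by rewrite bformE big1 // => j _; rewrite mul0mx mxE mul0r.
  have Du := bform_diag_gt0 d_gt0 u0.
  pose g := u *m D *m invmx N.
  have gN : g *m N = u *m D by rewrite mulmxKV.
  have gu : bform N g u = bform D u u by rewrite /bform gN.
  have gg : bform N g g = bform (D *m invmx N *m D) u u.
    rewrite /bform gN /g !trmx_mul !trmx_inv symN tr_diag_mx.
    by rewrite !mulmxA.
  have := psd_cauchy_schwarz g u (symN m) Sm; rewrite -/N gu gg => CS.
  have : bform D u u <= C' * bform N u u.
    rewrite -(ler_pM2l Du) -expr2 (le_trans CS) //.
    rewrite mulrA ler_wpM2r ?Sm // mulrC.
    by rewrite (le_trans (ler_norm _)) // mulrC bnd.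
  rewrite /N !bform_pencil mulrBl.
  rewrite -(ler_pdivrMl _ _ C'_gt0); lra.
move=> /(ge_inf infS.2); rewrite -/m.
have : 0 < C'^-1 by rewrite invr_gt0.
by lra.
Qed.

End QuadraticForms.

(** * The normalized Laplacian of one graph as a symmetric pencil *)

Section GraphSpectrum.
Variables (R : realType) (G : sgraph).
Implicit Types (u : 'rV[R]_#|G|) (f : G -> R) (a : R).

Definition fun_of_row u : G -> R := fun x => u 0 (enum_rank x).

Definition row_of_fun f : 'rV[R]_#|G| := \row_i f (enum_val i).

Lemma row_of_funK f : fun_of_row (row_of_fun f) =1 f.
Proof. by move=> x; rewrite /fun_of_row mxE enum_rankK. Qed.

Lemma sum_enum_val f : \sum_(i < #|G|) f (enum_val i) = \sum_x f x.
Proof. by rewrite -big_enum_val. Qed.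

Lemma sum_nbr1 (x : G) : \sum_(w | adj x w) 1 = (deg x)%:R :> R.
Proof. by rewrite sumr_const. Qed.

(** [laplacian] is not symmetric in general; multiplying [a - L] by the degree matrix gives the
    symmetric matrix of the form [a D(f) - Q(f)]. *)
Definition pencil a : 'M[R]_#|G| := a *: deg_mx R G - (deg_mx R G - adj_mx R G).

(* The function [D ((a - 1) f + D^-1 A f) = D (a f - L f)]. *)
Definition pencil_fun a f : G -> R :=
  fun x => \sum_(w | adj x w) ((a - 1) * f x + f w).

Lemma eq_pencil_fun a f g : f =1 g -> pencil_fun a f =1 pencil_fun a g.
Proof. by move=> fg x; apply: eq_bigr => w _; rewrite !fg. Qed.

Lemma pencil_funE a f x :
  pencil_fun a f x = (a - 1) * (deg x)%:R * f x + \sum_(w | adj x w) f w.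
Proof.
rewrite /pencil_fun big_split /=; congr (_ + _).
by rewrite -sum_nbr1 mulrAC mulr_sumr; apply: eq_bigr => w _; rewrite mulr1.
Qed.

Lemma mulmx_pencil a u i :
  (u *m pencil a) 0 i = pencil_fun a (fun_of_row u) (enum_val i).
Proof.
rewrite pencil_funE /pencil opprB addrA mulmxBr mulmxDr -scalemxAr.
rewrite mul_mx_diag !mxE /fun_of_row enum_valK.
have -> : \sum_j u 0 j * adj_mx R G j i =
    \sum_(w | adj (enum_val i) w) u 0 (enum_rank w).
  rewrite [RHS]big_mkcond -sum_enum_val; apply: eq_bigr => j _.
  by rewrite mxE enum_valK adj_sym; case: ifP; rewrite ?mulr1 ?mulr0.
by ring.
Qed.

Lemma pencil_eq0P a u :
  u *m pencil a = 0 <-> forall x, pencil_fun a (fun_of_row u) x = 0.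
Proof.
split=> [u0 x|u0]; last by apply/rowP => i; rewrite mulmx_pencil u0 mxE.
by rewrite -[x]enum_rankK -mulmx_pencil u0 mxE.
Qed.

Lemma bform_pencil_fun a u :
  bform (pencil a) u u =
  \sum_x pencil_fun a (fun_of_row u) x * fun_of_row u x.
Proof.
rewrite bformE -sum_enum_val; apply: eq_bigr => i _.
by rewrite mulmx_pencil /fun_of_row enum_valK.
Qed.

Lemma tr_adj_mx : (adj_mx R G)^T = adj_mx R G.
Proof. by apply/matrixP => i j; rewrite !mxE adj_sym. Qed.

Lemma tr_lap : (deg_mx R G - adj_mx R G)^T = deg_mx R G - adj_mx R G.
Proof. by rewrite linearB /= tr_diag_mx tr_adj_mx. Qed.

Lemma tr_pencil a : (pencil a)^T = pencil a.
Proof. by rewrite linearB linearZ /= tr_lap tr_diag_mx. Qed.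

Hypothesis deg_gt0 : forall v : G, (0 < deg v)%N.

Lemma deg_mx_unit : deg_mx R G \in unitmx.
Proof.
rewrite unitmxE det_diag unitfE prodf_seq_neq0; apply/allP => i _ /=.
by rewrite mxE pnatr_eq0 -lt0n deg_gt0.
Qed.

Lemma pencil_factor a :
  pencil a = (a%:M - (laplacian R G)^T) *m deg_mx R G.
Proof.
rewrite /laplacian linearB /= trmx_mul trmx_inv trmx1 tr_diag_mx.
rewrite opprB addrA !mulmxDl mulNmx mul1mx mul_scalar_mx mulmxKV ?deg_mx_unit //.
by rewrite tr_adj_mx /pencil opprB addrA addrAC.
Qed.

(** The degree matrix is invertible, so multiplying by it on the right leaves the left kernel
    unchanged. *)
Lemma eigenspace_pencil a u :
  (u <= eigenspace (laplacian R G)^T a)%MS <-> u *m pencil a = 0.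
Proof.
rewrite pencil_factor mulmxA; split=> [/eigenspaceP u_eig | u0].
  by rewrite mulmxBr u_eig mul_mx_scalar subrr mul0mx.
apply/eigenspaceP; move/(congr1 (mulmx^~ (invmx (deg_mx R G)))): u0.
rewrite mulmxK ?deg_mx_unit // mul0mx mulmxBr mul_mx_scalar => /eqP.
by rewrite subr_eq0 eq_sym => /eqP.
Qed.

Lemma degree_row_gt0 (i : 'I_#|G|) :
  0 < (\row_i (deg (enum_val i))%:R : 'rV[R]_#|G|) 0 i.
Proof. by rewrite mxE ltr0n deg_gt0. Qed.

Lemma pencil_eigenvalue a :
  eigenvalue (laplacian R G)^T a <-> exists2 u : 'rV[R]_#|G|, u != 0 & u *m pencil a = 0.
Proof.
split=> [/eigenvalueP[u u_eig u0]|[u u0 ua]].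
  by exists u => //; apply/eigenspace_pencil/eigenspaceP.
by apply/eigenvalueP; exists u => //; apply/eigenspaceP/eigenspace_pencil.
Qed.

(** At some eigenvalue [m] the pencil is semidefinite, which forces [m] to bound every eigenvalue;
    raising [a] above [m] only adds a nonnegative multiple of the degree form. *)
Lemma psd_pencil a : (0 < #|G|)%N -> lambda_max R G <= a -> psd (pencil a).
Proof.
move=> G_gt0.
have [m psdm eigm] := pencil_max_eigenvalue G_gt0 degree_row_gt0 tr_lap.
have max_m b : eigenvalue (laplacian R G)^T b -> b <= m.
  case/pencil_eigenvalue => v v0 vb.
  have := psdm v; rewrite bform_pencil.
  have : bform (pencil b) v v = 0 by rewrite /bform vb mul0mx mxE.
  rewrite bform_pencil => /eqP; rewrite subr_eq0 => /eqP <-.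
  rewrite -mulrBl pmulr_lge0 ?subr_ge0 // bform_diag_gt0 //.
  exact: degree_row_gt0.
(* [lambda_max] falls back on 0 if there is no greatest eigenvalue, so its defining property
   requires a witness, here [m]. *)
have [_ ge_lmax] : [set b | eigenvalue (laplacian R G)^T b /\
    forall c, eigenvalue (laplacian R G)^T c -> c <= b]%classic (lambda_max R G).
  by apply: xgetPex; exists m; split=> //; apply/pencil_eigenvalue.
have m_le : m <= lambda_max R G by apply: ge_lmax; apply/pencil_eigenvalue.
move=> /(le_trans m_le) le_ma u.
apply: le_trans (psdm u) _; rewrite !bform_pencil lerD2r ler_wpM2r //.
by apply: bform_diag_ge0; apply: degree_row_gt0.
Qed.

Lemma RQ_row u :
  RQ (fun_of_row u) = bform (deg_mx R G - adj_mx R G) u u / bform (deg_mx R G) u u.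
Proof.
have degE : bform (deg_mx R G) u u = \sum_v (deg v)%:R * fun_of_row u v ^+ 2.
  rewrite bform_diag -sum_enum_val; apply: eq_bigr => i _.
  by rewrite mxE -expr2 /fun_of_row enum_valK.
rewrite /RQ -degE; congr (_ / _).
(* At [a = 0] the pencil is [- (D - A)], hence the change of sign. *)
have := bform_pencil_fun 0 u; rewrite bform_pencil mul0r sub0r.
move=> /(congr1 -%R); rewrite opprK => ->.
pose f := fun_of_row u; rewrite -/f.
have sq2 : \sum_v \sum_(w | adj v w) f w ^+ 2 = \sum_v \sum_(w | adj v w) f v ^+ 2.
  rewrite (exchange_big_dep xpredT) //=; apply: eq_bigr => v _.
  by apply: eq_bigl => w; rewrite adj_sym.
have -> : \sum_v \sum_(w | adj v w) (f v - f w) ^+ 2 =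
    2 * \sum_v \sum_(w | adj v w) (f v ^+ 2 - f v * f w).
  (* The added bracket is zero by [sq2]; it makes the identity hold summand by summand. *)
  transitivity (\sum_v \sum_(w | adj v w) (2 * (f v ^+ 2 - f v * f w)) +
     (\sum_v \sum_(w | adj v w) f w ^+ 2 - \sum_v \sum_(w | adj v w) f v ^+ 2)).
    rewrite -sumrB -big_split; apply: eq_bigr => v _ /=.
    by rewrite -sumrB -big_split; apply: eq_bigr => w _ /=; ring.
  rewrite sq2 subrr addr0 mulr_sumr; apply: eq_bigr => v _.
  by rewrite mulr_sumr.
rewrite mulKf ?pnatr_eq0 // -sumrN; apply: eq_bigr => v _.
by rewrite /pencil_fun mulr_suml -sumrN; apply: eq_bigr => w _; ring.
Qed.

(** For nonzero [u], having Rayleigh quotient [a] means being isotropic for the semidefinite pencil,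
    hence an eigenfunction. The matrix product lists the values at [x] of rows spanning the
    eigenspace. *)
Lemma RQ_vanish_atP a (x : G) : lambda_max R G <= a ->
  RQ_vanish_at a x <->
  eigenspace (laplacian R G)^T a *m delta_mx (enum_rank x) (0 : 'I_1) = 0.
Proof.
move=> le_a; have psda : psd (pencil a).
  by apply: psd_pencil le_a; apply/card_gt0P; exists x.
have colE u : (u *m delta_mx (enum_rank x) (0 : 'I_1)) 0 0 = fun_of_row u x.
  by rewrite -colE mxE.
have RQ_eig u : u != 0 -> RQ (fun_of_row u) = a <-> u *m pencil a = 0.
  move=> u0; have Du : 0 < bform (deg_mx R G) u u.
    by apply: bform_diag_gt0 => //; apply: degree_row_gt0.
  rewrite RQ_row; split=> [eq_a|ua].
    apply: psd_isotropic; rewrite ?tr_pencil // bform_pencil -eq_a.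
    by rewrite divfK ?subrr // gt_eqF.
  have : bform (pencil a) u u = 0 by rewrite /bform ua mul0mx mxE.
  rewrite bform_pencil => /eqP; rewrite subr_eq0 => /eqP <-.
  by rewrite mulfK // gt_eqF.
split=> [van|Ex h [v hv] RQh].
  apply/row_matrixP => i; rewrite row_mul row0; apply/rowP => j.
  rewrite ord1 [RHS]mxE; set u := row i _.
  have uE : (u <= eigenspace (laplacian R G)^T a)%MS by apply: row_sub.
  have [->|u0] := eqVneq u 0; first by rewrite mul0mx mxE.
  rewrite colE; apply: van.
    have /rV0Pn[k uk] := u0; exists (enum_val k).
    by rewrite /fun_of_row enum_valK.
  by apply/RQ_eig/eigenspace_pencil.
have hK := funext (row_of_funK h); rewrite -hK.
have /submxP[m ->] : (row_of_fun h <= eigenspace (laplacian R G)^T a)%MS.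
  apply/eigenspace_pencil/RQ_eig; last by rewrite hK.
  by apply/rV0Pn; exists (enum_rank v); rewrite mxE enum_rankK.
by rewrite -colE -mulmxA Ex mulmx0 mxE.
Qed.

End GraphSpectrum.

(** * Embeddings of the two parts in the 1-sum, and locality of the eigenvalue equation *)

Section OneSumSpectrum.
Variables (R : realType) (G1 G2 : sgraph) (x1 : G1) (x2 : G2).
Let G := onesum x1 x2.

Definition inc1 (x : G1) : G := onesum_proj x1 x2 (inl x).
Definition inc2 (x : G2) : G := onesum_proj x1 x2 (inr x).

Lemma inc1_base : inc1 x1 = None.
Proof. by rewrite /inc1 /= insubF ?eqxx. Qed.

Lemma inc2_base : inc2 x2 = None.
Proof. by rewrite /inc2 /= insubF ?eqxx. Qed.

Lemma inc1_val (s : {x : G1 | x != x1}) : inc1 (val s) = Some (inl s).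
Proof. by rewrite /inc1 /= valK. Qed.

Lemma inc2_val (s : {x : G2 | x != x2}) : inc2 (val s) = Some (inr s).
Proof. by rewrite /inc2 /= valK. Qed.

Lemma inc1_inj : injective inc1.
Proof.
rewrite /inc1 => x y /=.
case: insubP => [s _ <-|]; case: insubP => [t _ <-|] //=; first by case=> ->.
by rewrite !negbK => /eqP-> /eqP->.
Qed.

Lemma inc2_inj : injective inc2.
Proof.
rewrite /inc2 => x y /=.
case: insubP => [s _ <-|]; case: insubP => [t _ <-|] //=; first by case=> ->.
by rewrite !negbK => /eqP-> /eqP->.
Qed.

Lemma inc12_eq x y : inc1 x = inc2 y -> x = x1 /\ y = x2.
Proof.
rewrite /inc1 /inc2 /=.
case: insubP => [s _ _|]; case: insubP => [t _ _|] //=.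
by rewrite !negbK => /eqP-> /eqP->.
Qed.

Lemma adj_inc1 x y : @adj G (inc1 x) (inc1 y) = adj x y.
Proof.
apply/idP/idP => [/existsP[[s|s]] /existsP[[t|t]] /and3P[]//|xy].
- by move=> /eqP/inc1_inj-> /eqP/inc1_inj->.
(* An edge coming from [G2] would have both ends equal to [x2], hence be a loop. *)
- move=> /eqP/esym/inc12_eq[_ ->] /eqP/esym/inc12_eq[_ ->].
  by rewrite /= adj_irrefl.
by apply/existsP; exists (inl x); apply/existsP; exists (inl y); rewrite !eqxx.
Qed.

Lemma adj_inc2 x y : @adj G (inc2 x) (inc2 y) = adj x y.
Proof.
apply/idP/idP => [/existsP[[s|s]] /existsP[[t|t]] /and3P[]//|xy].
- move=> /eqP/inc12_eq[-> _] /eqP/inc12_eq[-> _].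
  by rewrite /= adj_irrefl.
- by move=> /eqP/inc2_inj-> /eqP/inc2_inj->.
by apply/existsP; exists (inr x); apply/existsP; exists (inr y); rewrite !eqxx.
Qed.

Lemma adj_inc12 x y : x != x1 -> y != x2 -> @adj G (inc1 x) (inc2 y) = false.
Proof.
move=> nx ny; apply: contraNF nx => /existsP[[s|s]] /existsP[[t|t]] /and3P[]//.
- by move=> _ /eqP/inc12_eq[_ y2]; rewrite y2 eqxx in ny.
- by move=> /eqP/esym/inc12_eq[-> _].
Qed.

Lemma sum_onesum (P : pred G) (F : G -> R) :
  \sum_(w | P w) F w =
  (if P None then F None else 0) +
  (\sum_(x | (x != x1) && P (inc1 x)) F (inc1 x) +
   \sum_(x | (x != x2) && P (inc2 x)) F (inc2 x)).
Proof.
rewrite big_mkcond (bigD1 None) //=; congr (_ + _).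
rewrite (reindex_omap Some id) /= => [|[w|//]//].
under eq_bigl do rewrite eqxx.
rewrite big_sumType /=.
rewrite (big_sub_cond [pred x | x != x1] (fun x => P (inc1 x))).
rewrite (big_sub_cond [pred x | x != x2] (fun x => P (inc2 x))).
congr (_ + _); rewrite [RHS]big_mkcond.
  by apply: eq_bigr => s _; rewrite inc1_val.
by apply: eq_bigr => s _; rewrite inc2_val.
Qed.

(** A vertex of [G1] other than [x1] has all its neighbours inside [G1], so the eigenvalue equation
    there does not see the rest of [G2]. *)
Lemma pencil_fun_inc1 (a : R) (f : G -> R) x : x != x1 ->
  pencil_fun a f (inc1 x) = pencil_fun a (f \o inc1) x.
Proof.
move=> nx; rewrite /pencil_fun sum_onesum -inc1_base adj_inc1.
rewrite [X in _ + (_ + X)]big_pred0 => [|y]; last first.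
  by case: (eqVneq y x2) => [//|ny]; apply: adj_inc12.
rewrite addr0 [RHS]big_mkcond (bigD1 x1 isT); congr (_ + _).
rewrite -big_mkcondr; apply: eq_bigl => y.
by rewrite adj_inc1.
Qed.

Lemma pencil_fun_inc2 (a : R) (f : G -> R) x : x != x2 ->
  pencil_fun a f (inc2 x) = pencil_fun a (f \o inc2) x.
Proof.
move=> nx; rewrite /pencil_fun sum_onesum -inc2_base adj_inc2.
rewrite [X in _ + (X + _)]big_pred0 => [|y]; last first.
  by case: (eqVneq y x1) => [//|ny]; rewrite adj_sym; apply: adj_inc12.
rewrite add0r [RHS]big_mkcond (bigD1 x2 isT); congr (_ + _).
rewrite -big_mkcondr; apply: eq_bigl => y.
by rewrite adj_inc2.
Qed.

(** The neighbours of the glued vertex are those of [x1] and those of [x2], and each neighbour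
    brings its own share of the degree term. *)
Lemma pencil_fun_glued (a : R) (f : G -> R) :
  pencil_fun a f None =
  pencil_fun a (f \o inc1) x1 + pencil_fun a (f \o inc2) x2.
Proof.
rewrite /pencil_fun sum_onesum (adj_irrefl (s := G)) add0r; congr (_ + _).
  rewrite -inc1_base; apply: eq_bigl => y; rewrite adj_inc1.
  by case: eqVneq => // ->; rewrite adj_irrefl.
rewrite -inc2_base; apply: eq_bigl => y; rewrite adj_inc2.
by case: eqVneq => // ->; rewrite adj_irrefl.
Qed.

(* The quadratic form of a 1-sum is the sum of the forms of the two parts, so
   when both are nonnegative an isotropic function is isotropic on each part. *)
Lemma pencil_onesum_eq0 (a : R) (u : 'rV[R]_#|G|)
    (u1 := row_of_fun (fun_of_row u \o inc1))
    (u2 := row_of_fun (fun_of_row u \o inc2)) :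
    psd (pencil G1 a) -> psd (pencil G2 a) ->
  u *m pencil G a = 0 <-> u1 *m pencil G1 a = 0 /\ u2 *m pencil G2 a = 0.
Proof.
move=> psd1 psd2; set f := fun_of_row u.
have E1 := eq_pencil_fun a (row_of_funK (f \o inc1)).
have E2 := eq_pencil_fun a (row_of_funK (f \o inc2)).
split=> [u0|[/pencil_eq0P u10 /pencil_eq0P u20]]; last first.
  apply/pencil_eq0P => -[[s|s]|]; rewrite -/f.
  - by rewrite -inc1_val pencil_fun_inc1 ?(valP s) // -E1.
  - by rewrite -inc2_val pencil_fun_inc2 ?(valP s) // -E2.
  - by rewrite pencil_fun_glued -E1 -E2 u10 u20 addr0.
(* At the glued vertex [u0] only says that the values at [x1] and [x2] cancel; semidefiniteness is
   what separates the parts. *)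
have sum0 : bform (pencil G1 a) u1 u1 + bform (pencil G2 a) u2 u2 = 0.
  have : bform (pencil G a) u u = 0 by rewrite /bform u0 mul0mx mxE.
  rewrite bform_pencil_fun => <-; rewrite !bform_pencil_fun.
  rewrite sum_onesum /= -/f pencil_fun_glued -E1 -E2.
  rewrite (bigD1 x1) //= [X in _ + X = _](bigD1 x2) //=.
  rewrite !row_of_funK /= inc1_base inc2_base -/f mulrDl addrACA.
  congr (_ + (_ + _)).
    apply: eq_big => [y|y ny]; first by rewrite andbT.
    by rewrite pencil_fun_inc1 // E1 row_of_funK.
  apply: eq_big => [y|y ny]; first by rewrite andbT.
  by rewrite pencil_fun_inc2 // E2 row_of_funK.
move/eqP: sum0; rewrite paddr_eq0 // => /andP[/eqP iso1 /eqP iso2].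
by split; apply: psd_isotropic => //; apply: tr_pencil.
Qed.

(** * Dimension count for the eigenspaces of the 1-sum *)

Hypotheses (deg1 : forall v : G1, (0 < deg v)%N)
           (deg2 : forall v : G2, (0 < deg v)%N).

Lemma deg_onesum_gt0 (v : G) : (0 < deg v)%N.
Proof.
have deg_ex (H : sgraph) (x : H) : (0 < deg x)%N <-> exists y, adj x y.
  by split=> [/card_gt0P[y]|[y xy]]; [exists y | apply/card_gt0P; exists y].
case: v => [[s|s]|]; rewrite -?inc1_val -?inc2_val -?inc1_base; apply/deg_ex.
- by have [y xy] := (deg_ex _ _).1 (deg1 (val s)); exists (inc1 y); rewrite adj_inc1.
- by have [y xy] := (deg_ex _ _).1 (deg2 (val s)); exists (inc2 y); rewrite adj_inc2.
- by have [y xy] := (deg_ex _ _).1 (deg1 x1); exists (inc1 y); rewrite adj_inc1.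
Qed.

Definition restrict_mx : 'M[R]_(#|G|, #|G1| + #|G2|) :=
  row_mx (\matrix_(i, j) (enum_val i == inc1 (enum_val j))%:R)
         (\matrix_(i, j) (enum_val i == inc2 (enum_val j))%:R).

Lemma mul_restrict_mx (u : 'rV[R]_#|G|) :
  u *m restrict_mx = row_mx (row_of_fun (fun_of_row u \o inc1))
                            (row_of_fun (fun_of_row u \o inc2)).
Proof.
have sumE (x : G) : \sum_i u 0 i * (enum_val i == x)%:R = fun_of_row u x.
  rewrite (bigD1 (enum_rank x)) //= enum_rankK eqxx mulr1 big1 ?addr0 // => i ni.
  by rewrite -(can_eq enum_rankK) enum_valK (negPf ni) mulr0.
rewrite mul_mx_row; congr row_mx; apply/rowP => j; rewrite !mxE /= -sumE;
  by apply: eq_bigr => i _; rewrite mxE.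
Qed.

(** The two embeddings cover the vertices of [G], so a function is determined by its restrictions;
    hence restricting preserves ranks. *)
Lemma restrict_mx_free : row_free restrict_mx.
Proof.
rewrite -kermx_eq0; apply/eqP/row_matrixP => i; rewrite row0.
have : row i (kermx restrict_mx) *m restrict_mx = 0.
  by apply/sub_kermxP/row_sub.
rewrite mul_restrict_mx -row_mx0 => /eq_row_mx[u1 u2].
set u := row i _ in u1 u2 *; apply/rowP => j; rewrite [RHS]mxE.
rewrite -[j]enum_valK -/(fun_of_row u _).
case: (enum_val j) => [[s|s]|]; rewrite -?inc1_val -?inc2_val -?inc1_base.
- by rewrite -[LHS]/((_ \o inc1) _) -row_of_funK u1 /fun_of_row mxE.
- by rewrite -[LHS]/((_ \o inc2) _) -row_of_funK u2 /fun_of_row mxE.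
- by rewrite -[LHS]/((_ \o inc1) _) -row_of_funK u1 /fun_of_row mxE.
Qed.

(** The functional [v1 x1 - v2 x2] on pairs; its kernel consists of the pairs that glue to a
    function on [G]. *)
Definition glue_mx : 'cV[R]_(#|G1| + #|G2|) :=
  col_mx (delta_mx (enum_rank x1) 0) (- delta_mx (enum_rank x2) 0).

Lemma eigenspace_onesum (a : R) :
    lambda_max R G1 <= a -> lambda_max R G2 <= a ->
  (eigenspace (laplacian R G)^T a *m restrict_mx :=:
   block_mx (eigenspace (laplacian R G1)^T a) 0
            0 (eigenspace (laplacian R G2)^T a) :&: kermx glue_mx)%MS.
Proof.
move=> le1 le2.
have psd1 : psd (pencil G1 a) by apply: psd_pencil => //; apply/card_gt0P; exists x1.
have psd2 : psd (pencil G2 a) by apply: psd_pencil => //; apply/card_gt0P; exists x2.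
have glueE (v1 : 'rV[R]_#|G1|) (v2 : 'rV[R]_#|G2|) :
    row_mx v1 v2 *m glue_mx = 0 <-> fun_of_row v1 x1 = fun_of_row v2 x2.
  rewrite mul_row_col mulmxN -!colE.
  split=> [/colP/(_ 0)|eq12]; last apply/colP => i; rewrite ?[i]ord1 !mxE.
    by move/eqP; rewrite subr_eq0 => /eqP.
  by rewrite -!/(fun_of_row _ _) eq12 subrr.
have blockE (v1 : 'rV[R]_#|G1|) (v2 : 'rV[R]_#|G2|) :
    (row_mx v1 v2 <= block_mx (eigenspace (laplacian R G1)^T a) 0
            0 (eigenspace (laplacian R G2)^T a))%MS <->
    v1 *m pencil G1 a = 0 /\ v2 *m pencil G2 a = 0.
  split=> [/submxP[w]|[/(eigenspace_pencil deg1)/submxP[w1 ->]]].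
    rewrite -[w]hsubmxK mul_row_block !mulmx0 addr0 add0r => /eq_row_mx[-> ->].
    by split; apply/eigenspace_pencil => //; apply: submxMl.
  move=> /(eigenspace_pencil deg2)/submxP[w2 ->].
  apply/submxP; exists (row_mx w1 w2).
  by rewrite mul_row_block !mulmx0 addr0 add0r.
apply/eqmxP/andP; split; apply/row_subP => i.
  rewrite row_mul; set u := row i _.
  have /(eigenspace_pencil deg_onesum_gt0) : 
    (u <= eigenspace (laplacian R G)^T a)%MS by apply: row_sub.
  move=> /(pencil_onesum_eq0 _ psd1 psd2) u0.
  rewrite sub_capmx mul_restrict_mx; apply/andP; split; first exact/blockE.
  by apply/sub_kermxP/glueE; rewrite !row_of_funK /= inc1_base inc2_base.
set v := row i _.
have : (v <= _ :&: _)%MS := row_sub i _.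
rewrite sub_capmx -[v]hsubmxK => /andP[/blockE v0 /sub_kermxP/glueE glued].
(* The glued vertex takes its value from the first part; [glued] makes it agree with the second. *)
pose f (w : G) := match w with
  | None => fun_of_row (lsubmx v) x1
  | Some (inl s) => fun_of_row (lsubmx v) (val s)
  | Some (inr s) => fun_of_row (rsubmx v) (val s)
  end.
have f1 : row_of_fun (f \o inc1) = lsubmx v.
  apply/rowP => j; rewrite mxE /=; transitivity (fun_of_row (lsubmx v) (enum_val j)).
    have [->|nx] := eqVneq (enum_val j) x1; first by rewrite inc1_base.
    by rewrite -[enum_val j]/(val (exist (fun x => x != x1) _ nx)) inc1_val.
  by rewrite /fun_of_row enum_valK.
have f2 : row_of_fun (f \o inc2) = rsubmx v.
  apply/rowP => j; rewrite mxE /=; transitivity (fun_of_row (rsubmx v) (enum_val j)).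
    have [->|nx] := eqVneq (enum_val j) x2; first by rewrite inc2_base /= glued.
    by rewrite -[enum_val j]/(val (exist (fun x => x != x2) _ nx)) inc2_val.
  by rewrite /fun_of_row enum_valK.
have fE := funext (row_of_funK f).
have fv : row_of_fun f *m restrict_mx = row_mx (lsubmx v) (rsubmx v).
  by rewrite mul_restrict_mx fE f1 f2.
rewrite -fv; apply: submxMr; apply/(eigenspace_pencil deg_onesum_gt0).
by apply/pencil_onesum_eq0 => //; rewrite fE f1 f2.
Qed.

(** Rank-nullity for [glue_mx] on the direct sum of the two eigenspaces: the kernel has dimension
    [mult G a], and the boolean, read as 0 or 1, is the rank of the functional there. *)
Lemma mult_onesum (a : R) :
    lambda_max R G1 <= a -> lambda_max R G2 <= a ->
  (mult G1 a + mult G2 a = mult G a +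
    (`[< ~ (RQ_vanish_at a x1 /\ RQ_vanish_at a x2) >]))%N.
Proof.
move=> le1 le2.
(* Only the multiplicity in [G] is unfolded, to replace the eigenspace by its image under the
   injective restriction. *)
rewrite {3}/mult -(mxrankMfree _ restrict_mx_free) eigenspace_onesum //.
rewrite /mult -rank_diag_block_mx -(mxrank_mul_ker _ glue_mx) addnC; congr addn.
have vanE : block_mx (eigenspace (laplacian R G1)^T a) 0
    0 (eigenspace (laplacian R G2)^T a) *m glue_mx = 0 <->
    RQ_vanish_at a x1 /\ RQ_vanish_at a x2.
  rewrite mul_block_col !mul0mx addr0 add0r mulmxN.
  rewrite RQ_vanish_atP // RQ_vanish_atP //.
  split=> [|[-> ->]]; last by rewrite oppr0 col_mx0.
  rewrite -col_mx0 => /eq_col_mx[-> /eqP].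
  by rewrite oppr_eq0 => /eqP.
case: asboolP => [nvan|/contrapT/vanE ->]; last by rewrite mxrank0.
(* A matrix with one column has rank at most 1, and exactly 1 if it is nonzero. *)
apply/eqP; rewrite eqn_leq rank_leq_col lt0n mxrank_eq0.
by apply/eqP => /vanE.
Qed.

End OneSumSpectrum.

(** The smaller value is expressed with [+ 1] on the left because subtraction of natural numbers
    truncates. *)
Theorem theorem5p15 (R : realType) (G1 G2 : sgraph) (x1 : G1) (x2 : G2)
    (conn1 : connected_graph G1) (conn2 : connected_graph G2)
    (deg1 : forall v : G1, (0 < deg v)%N) (deg2 : forall v : G2, (0 < deg v)%N)
    (le21 : lambda_max R G2 <= lambda_max R G1) :
  let G := onesum x1 x2 in
  let mu := lambda_max R G1 in
  (mult G mu = (mult G1 mu + mult G2 mu)%N \/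
   (mult G mu + 1)%N = (mult G1 mu + mult G2 mu)%N) /\
  (RQ_vanish_at mu x1 /\ RQ_vanish_at mu x2 ->
   mult G mu = (mult G1 mu + mult G2 mu)%N) /\
  (~ (RQ_vanish_at mu x1 /\ RQ_vanish_at mu x2) ->
   (mult G mu + 1)%N = (mult G1 mu + mult G2 mu)%N).
Proof.
move=> G mu; rewrite (mult_onesum x1 x2 deg1 deg2 (lexx _) le21) -/G -/mu.
case: asboolP => van; rewrite ?addn0; split; auto; split=> // /van [].
Qed.
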